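(* Let $M$ be a (pseudo-)Riemannian manifold, $A$ a real constant, and let the `Hamilton function' be $$\mathfrak H=\pi_\alpha u^\alpha+\frac{\|u\|^3}{4}\,\pi^{(1)}\cdot\pi^{(1)}-A\,\|u\|,\qquad \|u\|=\sqrt{u\cdot u},\quad \gamma=u\cdot u>0 .$$ Let $x(\tau)$ be a curve with $u=dx/d\tau$ and covectors $\varpi,\varpi^{(1)}$ along it satisfying, for some function $\tilde\mu$, the covariant Hamilton equations of $\mathfrak H$, $$\begin{aligned} u'^{\,\alpha}&=\tfrac12\gamma^{3/2}\varpi^{(1)\alpha}+\tilde\mu\,u^\alpha,\\ \varpi'{}_\alpha&=-R_{\alpha\beta\rho}{}^{\nu}u^\rho u^\beta\varpi^{(1)}{}_\nu,\\ \varpi^{(1)\prime}{}_\alpha&=-\tfrac34\gamma^{1/2}\big(\varpi^{(1)}\cdot\varpi^{(1)}\big)u_\alpha-\varpi_\alpha-\tilde\mu\,\varpi^{(1)}{}_\alpha+\frac{A}{\sqrt\gamma}\,u_\alpha, \end{aligned}$$ together with the Zermelo condition $u^\alpha\varpi^{(1)}{}_\alpha=0$. Then $\tilde\mu=\dfrac{u\cdot u'}{\|u\|^2}$ and $$\varpi=6\frac{u'\cdot u}{\|u\|^5}\,u'+\left(2\frac{u''\cdot u}{\|u\|^5}-5\frac{(u'\cdot u)^2}{\|u\|^7}-\frac{u'\cdot u'}{\|u\|^5}\right)u-2\frac{u''}{\|u\|^3}+\frac{A}{\|u\|}\,u .$$ Moreover, in the natural parameter $s$ (for which $u\cdot u=1$)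 the equation $\varpi'{}_\alpha=-R_{\alpha\beta\rho}{}^{\nu}u^\rho u^\beta\varpi^{(1)}{}_\nu$ becomes the equation of motion $$\frac{D}{ds}\left[\Big(-3\,\frac{D^2x}{ds^2}\cdot\frac{D^2x}{ds^2}+A\Big)\frac{Dx_\alpha}{ds}-2\,\frac{D^3x_\alpha}{ds^3}\right]=-\varpi^{(1)}{}_\nu\,R_{\alpha\beta\rho}{}^{\nu}\,\frac{Dx^\rho}{ds}\frac{Dx^\beta}{ds}.$$
   Context: $g$ is the metric of $M$, $\Gamma^{\alpha}{}_{\beta\rho}$ its Levi-Civita Christoffel symbols; indices are raised and lowered with $g$, and $a\cdot b$ is the metric scalar product. A prime (or $\frac{D}{d\tau}$, respectively $\frac{D}{ds}$ when the parameter is $s$) denotes the covariant derivative along the curve: $u'^{\,\alpha}=\frac{du^\alpha}{d\tau}+\Gamma^{\alpha}{}_{\beta\rho}u^\beta u^\rho$, $a'{}_\alpha=\frac{da_\alpha}{d\tau}-\Gamma^{\rho}{}_{\alpha\beta}a_\rho u^\beta$ for covectors; $\frac{Dx}{ds}=\frac{dx}{ds}$. The curvature tensor is $$R_{\alpha\beta\rho}{}^{\nu}=\frac{\partial\Gamma^{\nu}{}_{\alpha\rho}}{\partial x^\beta}-\frac{\partial\Gamma^{\nu}{}_{\beta\rho}}{\partial x^\alpha}+\Gamma^{\nu}{}_{\beta\xi}\Gamma^{\xi}{}_{\alpha\rho}-\Gamma^{\nu}{}_{\alpha\xi}\Gamma^{\xi}{}_{\beta\rho}.$$ For a function $\mathfrak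 H$ of $\gamma=u\cdot u$, $\psi=\pi_\alpha u^\alpha$, $\eta=\pi^{(1)}\cdot\pi^{(1)}$ the covariant Hamilton equations are $dx/d\tau=u$, $u'=2\varpi^{(1)}\mathfrak H_\psi^{-1}\mathfrak H_\eta+\tilde\mu u$, $\varpi'{}_\alpha=-R_{\alpha\beta\rho}{}^{\nu}u^\rho u^\beta\varpi^{(1)}{}_\nu$, $\varpi^{(1)\prime}=-2u\,\mathfrak H_\psi^{-1}\mathfrak H_\gamma-\varpi-\tilde\mu\varpi^{(1)}$, where subscripts denote partial derivatives evaluated at $\pi=\varpi$, $\pi^{(1)}=\varpi^{(1)}$ (the covariant momenta along the curve). *)

(* Defs.v *)
From HB Require Import structures.
From mathcomp Require Import all_boot all_order all_algebra.
From mathcomp Require Import all_classical all_reals topology normedtype derive.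
Import Order.TTheory GRing.Theory Num.Theory.
Import numFieldNormedType.Exports.

Set Implicit Arguments.
Unset Strict Implicit.
Unset Printing Implicit Defensive.

Local Open Scope classical_set_scope.
Local Open Scope ring_scope.

Definition pd (R : realType) (n : nat) (a : 'I_n) (f : 'rV[R]_n -> R)
  (p : 'rV[R]_n) : R := 'D_(delta_mx 0 a) f p.

(* C^oo on an open set W: every iterated partial derivative is Frechet
   differentiable (hence continuous) on W. *)
Definition smooth_on (R : realType) (n : nat) (W : set 'rV[R]_n)
    (f : 'rV[R]_n -> R) : Prop :=
  forall (l : seq 'I_n) (p : 'rV[R]_n), W p ->
    differentiable (foldr (@pd R n) f l) p.

(* crd is a homeomorphism from the open set cdom onto an open subset of R^n,
   with inverse crd_inv; the values of crd and crd_inv elsewhere are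
   irrelevant. *)
Record chart (R : realType) (n : nat) (T : topologicalType) := Chart {
  cdom : set T;
  crd : T -> 'rV[R]_n;
  crd_inv : 'rV[R]_n -> T;
  cdom_open : open cdom;
  cimg_open : open (crd @` cdom);
  crdK : forall p, cdom p -> crd_inv (crd p) = p;
  crd_continuous : forall p, cdom p -> {for p, continuous crd};
  crd_inv_continuous :
    forall v, (crd @` cdom) v -> {for v, continuous crd_inv} }.

Definition transition (R : realType) (n : nat) (T : topologicalType)
  (c d : chart R n T) (v : 'rV[R]_n) : 'rV[R]_n := crd d (crd_inv c v).

Definition overlap (R : realType) (n : nat) (T : topologicalType)
  (c d : chart R n T) : set 'rV[R]_n := crd c @` (cdom c `&` cdom d).

(* The metric tensor is given by its component matrices g_{ab} in the charts of
   the atlas. It is only required to be nondegenerate, so that the signature is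
   arbitrary. *)
Record pseudoRiemannian (R : realType) (n : nat) := PseudoRiemannian {
  carrier :> topologicalType;
  carrier_hausdorff : hausdorff_space carrier;
  carrier_second_countable : @second_countable carrier;
  atlas : Type;
  chart_of : atlas -> chart R n carrier;
  atlas_cover : forall p : carrier, exists c, cdom (chart_of c) p;
  atlas_smooth : forall c d (k : 'I_n),
    smooth_on (overlap (chart_of c) (chart_of d))
      (fun v => transition (chart_of c) (chart_of d) v 0 k);
  metric : atlas -> 'rV[R]_n -> 'M[R]_n;
  metric_smooth : forall c (a b : 'I_n),
    smooth_on (crd (chart_of c) @` cdom (chart_of c))
      (fun v => metric c v a b);
  metric_sym : forall c v, (crd (chart_of c) @` cdom (chart_of c)) v ->
    (metric c v)^T = metric c v;
  metric_nondegenerate :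
    forall c v, (crd (chart_of c) @` cdom (chart_of c)) v ->
    metric c v \in unitmx;
  metric_transform : forall c d v, overlap (chart_of c) (chart_of d) v ->
    let phi := transition (chart_of c) (chart_of d) in
    forall a b : 'I_n, metric c v a b =
      \sum_r \sum_s metric d (phi v) r s *
        pd a (fun w => phi w 0 r) v * pd b (fun w => phi w 0 s) v }.

Arguments atlas {R n} M : rename.
Arguments chart_of {R n} M c : rename.
Arguments metric {R n} M c p : rename.

(* In the definitions down to motion_equation everything is written in the
   coordinates of one chart: g is the matrix of the metric, p a point of R^n,
   x the coordinate expression of a curve, and vectors and covectors are given
   by their components 'I_n -> R. *)

Definition lower (R : realType) (n : nat) (g : 'rV[R]_n -> 'M[R]_n)
  (p : 'rV[R]_n) (v : 'I_n -> R) (a : 'I_n) : R := \sum_b g p a b * v b.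

Definition raise (R : realType) (n : nat) (g : 'rV[R]_n -> 'M[R]_n)
  (p : 'rV[R]_n) (w : 'I_n -> R) (a : 'I_n) : R :=
  \sum_b invmx (g p) a b * w b.

Definition pairing (R : realType) (n : nat) (w v : 'I_n -> R) : R :=
  \sum_a w a * v a.

Definition dotv (R : realType) (n : nat) (g : 'rV[R]_n -> 'M[R]_n)
  (p : 'rV[R]_n) (v v' : 'I_n -> R) : R := \sum_a \sum_b g p a b * v a * v' b.

Definition dotc (R : realType) (n : nat) (g : 'rV[R]_n -> 'M[R]_n)
  (p : 'rV[R]_n) (w w' : 'I_n -> R) : R :=
  \sum_a \sum_b invmx (g p) a b * w a * w' b.

(* christoffel g p a b r = Gamma^a_{b r} *)
Definition christoffel (R : realType) (n : nat) (g : 'rV[R]_n -> 'M[R]_n)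
    (p : 'rV[R]_n) (a b r : 'I_n) : R :=
  2^-1 * \sum_s invmx (g p) a s *
    (pd b (fun q => g q s r) p + pd r (fun q => g q s b) p
     - pd s (fun q => g q b r) p).

(* curvature g p a b r v = R_{a b r}^v; this sign convention varies in the
   literature. *)
Definition curvature (R : realType) (n : nat) (g : 'rV[R]_n -> 'M[R]_n)
    (p : 'rV[R]_n) (a b r v : 'I_n) : R :=
  pd b (fun q => christoffel g q v a r) p
  - pd a (fun q => christoffel g q v b r) p
  + \sum_k christoffel g p v b k * christoffel g p k a r
  - \sum_k christoffel g p v a k * christoffel g p k b r.

Definition velocity (R : realType) (n : nat) (x : R -> 'rV[R]_n)
  (t : R) (a : 'I_n) : R := derive1 (fun s => x s 0 a) t.

Definition speed (R : realType) (n : nat) (g : 'rV[R]_n -> 'M[R]_n)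
    (x : R -> 'rV[R]_n) (t : R) : R :=
  Num.sqrt (dotv g (x t) (velocity x t) (velocity x t)).

(* covariant derivative along x of a vector, resp. covector, field along x *)
Definition covDv (R : realType) (n : nat) (g : 'rV[R]_n -> 'M[R]_n)
    (x : R -> 'rV[R]_n) (v : R -> 'I_n -> R) (t : R) (a : 'I_n) : R :=
  derive1 (fun s => v s a) t
  + \sum_b \sum_r christoffel g (x t) a b r * v t b * velocity x t r.

Definition covDc (R : realType) (n : nat) (g : 'rV[R]_n -> 'M[R]_n)
    (x : R -> 'rV[R]_n) (w : R -> 'I_n -> R) (t : R) (a : 'I_n) : R :=
  derive1 (fun s => w s a) t
  - \sum_r \sum_b christoffel g (x t) r a b * w t r * velocity x t b.

(* - R_{a b r}^v u^r u^b w1_v *)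
Definition curvature_force (R : realType) (n : nat) (g : 'rV[R]_n -> 'M[R]_n)
    (x : R -> 'rV[R]_n) (w1 : 'I_n -> R) (t : R) (a : 'I_n) : R :=
  - \sum_b \sum_r \sum_v
      curvature g (x t) a b r v * velocity x t r * velocity x t b * w1 v.

(* The covariant Hamilton equations at parameter t for a function
   H gamma psi eta; the equation dx/dtau = u is the definition of velocity. *)
Definition hamilton_equations (R : realType) (n : nat) (H : R -> R -> R -> R)
    (g : 'rV[R]_n -> 'M[R]_n) (x : R -> 'rV[R]_n) (w w1 : R -> 'I_n -> R)
    (mu : R -> R) (t : R) : Prop :=
  let u := velocity x in
  let gamma := dotv g (x t) (u t) (u t) in
  let psi := pairing (w t) (u t) in
  let eta := dotc g (x t) (w1 t) (w1 t) in
  let H_gamma := derive1 (fun z => H z psi eta) gamma in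
  let H_psi := derive1 (fun z => H gamma z eta) psi in
  let H_eta := derive1 (fun z => H gamma psi z) eta in
  forall a : 'I_n,
  [/\ covDv g x u t a
      = 2 * raise g (x t) (w1 t) a * H_psi^-1 * H_eta + mu t * u t a,
      covDc g x w t a = curvature_force g x (w1 t) t a
    & covDc g x w1 t a
      = - (2 * lower g (x t) (u t) a * H_psi^-1 * H_gamma) - w t a
        - mu t * w1 t a ].

Definition hamiltonian (R : realType) (A gamma psi eta : R) : R :=
  psi + Num.sqrt gamma ^+ 3 / 4 * eta - A * Num.sqrt gamma.

Definition motion_equation (R : realType) (n : nat) (A : R)
    (g : 'rV[R]_n -> 'M[R]_n) (x : R -> 'rV[R]_n) (w1 : R -> 'I_n -> R)
    (s : R) : Prop :=
  let u := velocity x in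
  let u' := covDv g x u in
  let u'' := covDv g x u' in
  forall a : 'I_n,
  covDc g x (fun t b =>
      (- 3 * dotv g (x t) (u' t) (u' t) + A) * lower g (x t) (u t) b
      - 2 * lower g (x t) (u'' t) b) s a
  = curvature_force g x (w1 s) s a.

Definition in_chart (R : realType) (n : nat) (M : pseudoRiemannian R n)
  (c : atlas M) (x : R -> M) (t : R) : 'rV[R]_n := crd (chart_of M c) (x t).

Definition sees (R : realType) (n : nat) (M : pseudoRiemannian R n)
  (c : atlas M) (x : R -> M) (t : R) : Prop := cdom (chart_of M c) (x t).

(* Three derivatives of x are the least for which D^3 x makes sense. *)
Definition curve_on (R : realType) (n : nat) (M : pseudoRiemannian R n)
    (I : set R) (x : R -> M) : Prop :=
  (forall t, I t -> {for t, continuous x}) /\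
  (forall (c : atlas M) t, I t -> sees c x t -> forall (a : 'I_n) (k : nat),
     (k < 3)%N -> derivable (derive1n k (fun s => in_chart c x s 0 a)) t 1).

(* A differentiable field of covectors along x: w c t is the tuple of its
   components in the chart c. *)
Definition covector_field_along (R : realType) (n : nat)
    (M : pseudoRiemannian R n) (I : set R) (x : R -> M)
    (w : atlas M -> R -> 'I_n -> R) : Prop :=
  (forall (c d : atlas M) t, I t -> sees c x t -> sees d x t ->
     forall a : 'I_n, w c t a =
       \sum_r w d t r *
         pd a (fun v => transition (chart_of M c) (chart_of M d) v 0 r)
           (in_chart c x t)) /\
  (forall (c : atlas M) t, I t -> sees c x t ->
     forall a : 'I_n, derivable (fun s => w c s a) t 1).

(* Main.v *)
(* Everything is local in a chart. Write u' and u'' for the covariant derivatives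
   of the velocity, N = ||u||, p = u . u', so that N' = p / N and
   p' = u' . u' + u . u''. Contracting the first Hamilton equation with u and
   using the Zermelo condition gives mu = p / N^2, and then solving it for the
   first momentum gives w1 = 2 u' / N^3 - 2 p u / N^5 (index lowered). This holds
   on an open set of parameters, so it can be differentiated covariantly;
   substituting into the third equation gives w. In a natural parameter,
   tau = theta s with theta' = 1 / N, the covariant derivatives of the velocity
   Dx/ds = u / N are explicit combinations of u, u', u'', and the bracket of the
   equation of motion is again w, now as a function of s; the second Hamilton
   equation then is the equation of motion. *)
Require Import Defs.
From mathcomp Require Import all_boot all_order all_algebra ring.
From mathcomp Require Import all_classical all_reals topology normedtype derive realfun.
Import Order.TTheory GRing.Theory Num.Theory.
Import numFieldNormedType.Exports.

Local Open Scope classical_set_scope.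
Local Open Scope ring_scope.

(** * Derivatives of real functions *)

Section RealDerivatives.
Set Implicit Arguments.
Unset Strict Implicit.
Context {R : realType}.
Implicit Types (f h : R -> R) (t : R).

Lemma is_derive_derive1 f t : derivable f t 1 -> is_derive t 1 f (derive1 f t).
Proof. by move=> df; rewrite derive1E; exact: derivableP. Qed.

Lemma derive1_is_derive f t d : is_derive t 1 f d -> derive1 f t = d.
Proof. by move=> [df <-]; rewrite derive1E. Qed.

Lemma is_derive_eq_on (O : set R) f h t d : open O -> O t ->
  (forall s, O s -> f s = h s) -> is_derive t 1 f d -> is_derive t 1 h d.
Proof.
move=> oO Ot fh; apply: near_eq_is_derive.
by apply: filterS (open_nbhs_nbhs (conj oO Ot)) => s /fh.
Qed.

Lemma derivable_eq_on (O : set R) f h t : open O -> O t ->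
  (forall s, O s -> f s = h s) -> derivable f t 1 -> derivable h t 1.
Proof.
by move=> oO Ot fh /is_derive_derive1/(is_derive_eq_on oO Ot fh)[].
Qed.

Lemma derive1_eq_on (O : set R) f h t : open O -> O t ->
  (forall s, O s -> f s = h s) -> derive1 f t = derive1 h t.
Proof.
move=> oO Ot fh; rewrite !derive1E; apply: near_eq_derive.
by apply: filterS (open_nbhs_nbhs (conj oO Ot)) => s /fh.
Qed.

Lemma is_derive_bigsum (J : Type) (r : seq J) (P : pred J) (F : J -> R -> R)
    (dF : J -> R) t :
  (forall j, P j -> is_derive t 1 (F j) (dF j)) ->
  is_derive t 1 (fun s => \sum_(j <- r | P j) F j s) (\sum_(j <- r | P j) dF j).
Proof.
move=> dFP; elim: r => [|j r ih].
  rewrite big_nil (_ : (fun s => _) = cst 0); first exact: is_derive_cst.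
  by apply: funext => s; rewrite big_nil.
rewrite big_cons.
rewrite (_ : (fun s => _) = (fun s => if P j then F j s + \sum_(i <- r | P i) F i s
  else \sum_(i <- r | P i) F i s)); last by apply: funext => s; rewrite big_cons.
by case: (boolP (P j)) => // Pj; apply: is_deriveD; exact: dFP.
Qed.

Lemma derivable_bigsum (J : Type) (r : seq J) (P : pred J) (F : J -> R -> R) t :
  (forall j, P j -> derivable (F j) t 1) ->
  derivable (fun s => \sum_(j <- r | P j) F j s) t 1.
Proof.
move=> dF; have dF1 j (Pj : P j) := is_derive_derive1 (dF j Pj).
by case: (is_derive_bigsum r dF1).
Qed.

Lemma derivable_bigprod (J : Type) (r : seq J) (P : pred J) (F : J -> R -> R) t :
  (forall j, P j -> derivable (F j) t 1) ->
  derivable (fun s => \prod_(j <- r | P j) F j s) t 1.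
Proof.
move=> dF; elim: r => [|j r ih].
  rewrite (_ : (fun s => _) = cst 1); first exact: derivable_cst.
  by apply: funext => s; rewrite big_nil.
rewrite (_ : (fun s => _) = (fun s => if P j then F j s * \prod_(i <- r | P i) F i s
  else \prod_(i <- r | P i) F i s)); last by apply: funext => s; rewrite big_cons.
by case: (boolP (P j)) => Pj; [exact: (derivableM (dF j Pj) ih)|exact: ih].
Qed.

Lemma derivable_det k (G : R -> 'M[R]_k) t :
  (forall i j, derivable (fun s => G s i j) t 1) ->
  derivable (fun s => \det (G s)) t 1.
Proof.
move=> dG; rewrite /determinant; apply: derivable_bigsum => s _.
by apply: derivableM; [exact: derivable_cst|exact: derivable_bigprod].
Qed.

(** Cramer's rule makes each entry of the inverse a cofactor over the determinant. The formula is
    valid only at invertible matrices, so invertibility is required on a whole neighbourhood of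
    [t]. *)
Lemma derivable_invmx (O : set R) k (G : R -> 'M[R]_k) t i j : open O -> O t ->
  (forall s, O s -> G s \in unitmx) ->
  (forall i j, derivable (fun s => G s i j) t 1) ->
  derivable (fun s => invmx (G s) i j) t 1.
Proof.
move=> oO Ot uG dG.
have: derivable (fun s => (\det (G s))^-1 *
    ((-1) ^+ (j + i) * \det (row' j (col' i (G s))))) t 1.
  apply: derivableM; last apply: derivableM.
  - apply: derivableV; last exact: derivable_det.
    by move: (uG _ Ot); rewrite unitmxE unitfE.
  - exact: derivable_cst.
  - apply: derivable_det => a b.
    rewrite (_ : (fun s => _) = (fun s => G s (lift j a) (lift i b))) //.
    by apply: funext => s; rewrite !mxE.
apply: derivable_eq_on oO Ot _ => s Os.
by rewrite /invmx (uG _ Os) !mxE /cofactor.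
Qed.

(* [is_derive_eq] with the equation at type [R], where [field] recognizes it. *)
Lemma is_derive_congr f t (d d' : R) :
  is_derive t 1 f d -> d = d' -> is_derive t 1 f d'.
Proof. exact: is_derive_eq. Qed.

Lemma is_derive_mul f h t (df dh : R) : is_derive t 1 f df -> is_derive t 1 h dh ->
  is_derive t 1 (fun s => f s * h s) (df * h t + f t * dh).
Proof.
move=> dfP dhP; apply: is_derive_eq (is_deriveM dfP dhP) _.
by rewrite addrC [X in X + _]mulrC.
Qed.

Lemma is_derive_scale (k : R) f t (df : R) : is_derive t 1 f df ->
  is_derive t 1 (fun s => k * f s) (k * df).
Proof. exact: is_deriveZ. Qed.

Lemma is_derive_expV f t (df : R) k : is_derive t 1 f df -> f t != 0 ->
  is_derive t 1 (fun s => (f s ^+ k)^-1) (- (k%:R * df / f t ^+ k.+1)).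
Proof.
move=> dfP ft0.
have dk : is_derive t 1 (fun s => f s ^+ k) (k%:R * f t ^+ k.-1 * df).
  rewrite -[fun s => _](exprfctE f k); exact: is_deriveX.
apply: is_derive_eq (is_deriveV _ dk) _; first by rewrite expf_neq0.
(* The power rule contains [k.-1], so [k = 0] is separated; both sides vanish there. *)
rewrite /GRing.scale /=; case: k {dk} => [|k]; first by rewrite !mul0r mulr0 oppr0.
rewrite mulNr; congr (- _); rewrite !exprS succnK.
have := expf_neq0 k ft0; move: (f t ^+ k) => y y0; field; exact/andP.
Qed.

Lemma is_derive_comp_sqrt f t (df : R) : is_derive t 1 f df -> 0 < f t ->
  is_derive t 1 (fun s => Num.sqrt (f s)) (df / (2 * Num.sqrt (f t))).
Proof.
move=> dfP ft0; have ds := is_derive1_sqrt ft0.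
by apply: is_derive_eq (is_derive1_comp ds dfP) _; rewrite mulrC.
Qed.

End RealDerivatives.

(** * Chain rule along a curve in coordinates *)

Section AlongCurve.
Set Implicit Arguments.
Unset Strict Implicit.
Context {R : realType} {n : nat}.
Implicit Types (f : 'rV[R]_n -> R) (X : R -> 'rV[R]_n) (t : R).

Lemma derivable_coord X t :
  (forall a, derivable (fun s => X s 0 a) t 1) <-> derivable X t 1.
Proof.
split=> [dX|/derivable_mxP dX a]; last exact: dX.
by apply/derivable_mxP => i a; rewrite ord1; exact: dX.
Qed.

(** The differential of [f] is linear; expanding the velocity on the standard basis turns its value
    into a combination of partial derivatives. *)
Lemma is_derive_comp_curve f X t : differentiable f (X t) ->
  (forall a, derivable (fun s => X s 0 a) t 1) ->
  is_derive t 1 (f \o X) (\sum_b pd b f (X t) * velocity X t b).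
Proof.
move=> df /derivable_coord dX.
have dX' : differentiable X t by apply/derivable1_diffP.
apply: DeriveDef; first by apply/derivable1_diffP; exact: differentiable_comp.
rewrite deriveE; last exact: differentiable_comp.
rewrite diff_comp //=; rewrite -(@deriveE _ _ _ X) // [X in 'd f _ X]row_sum_delta.
rewrite linear_sum; apply: eq_bigr => b _.
rewrite linearZ /= /pd deriveE // mulrC; congr (_ * _).
  by rewrite -(@deriveE _ _ _ X) // derive_mx // mxE /velocity derive1E.
by rewrite deriveE.
Qed.

End AlongCurve.

(** * Covariant differentiation along a curve *)

Section Geometry.
Set Implicit Arguments.
Unset Strict Implicit.
Context {R : realType} {n : nat}.
Implicit Types (W : set 'rV[R]_n) (O : set R) (g : 'rV[R]_n -> 'M[R]_n)
  (X : R -> 'rV[R]_n) (p : 'rV[R]_n) (t : R) (V Z : R -> 'I_n -> R) (f : R -> R)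
  (v z w : 'I_n -> R).

(** What the local theory uses of the metric in one chart, [W] being the image of the chart. *)
Record metric_on W g : Prop := MetricOn {
  metric_on_open : open W;
  metric_on_smooth : forall a b, smooth_on W (fun p => g p a b);
  metric_on_sym : forall p, W p -> (g p)^T = g p;
  metric_on_unit : forall p, W p -> g p \in unitmx }.

Definition field_derivable (V : R -> 'I_n -> R) t :=
  forall a, derivable (fun s => V s a) t 1.

(** The regularity is that of ordinary coordinate derivatives up to order three; differentiability
    of the covariant acceleration is deduced from it. *)
Record curve_in W O X : Prop := CurveIn {
  curve_in_open : open O;
  curve_in_sub : forall t, O t -> W (X t);
  curve_in_derivable : forall t, O t -> field_derivable (fun s a => X s 0 a) t;
  velocity_derivable : forall t, O t -> field_derivable (velocity X) t;
  acceleration_derivable : forall t, O t ->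
    field_derivable (fun s a => derive1 (fun s' => velocity X s' a) s) t }.

Lemma metric_onC W g p a b : metric_on W g -> W p -> g p a b = g p b a.
Proof. by move=> gW Wp; rewrite -[in LHS](metric_on_sym gW Wp) mxE. Qed.

Lemma lower_raise g p w a : g p \in unitmx -> lower g p (raise g p w) a = w a.
Proof.
move=> ug; rewrite /lower /raise.
under eq_bigr do rewrite mulr_sumr.
rewrite exchange_big /=.
have /matrixP gV := mulmxV ug.
under eq_bigr => c _.
  under eq_bigr do rewrite mulrA.
  rewrite -mulr_suml.
  have := gV a c; rewrite !mxE => ->; over.
rewrite (bigD1 a) //= eqxx mul1r big1 ?addr0 // => c ca.
by rewrite eq_sym (negbTE ca) mul0r.
Qed.

Lemma dotvE g p v z : dotv g p v z = \sum_a v a * lower g p z a.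
Proof.
rewrite /dotv /lower; apply: eq_bigr => a _; rewrite mulr_sumr.
by apply: eq_bigr => b _; rewrite mulrCA mulrA.
Qed.

Lemma dotvC W g p v z : metric_on W g -> W p -> dotv g p v z = dotv g p z v.
Proof.
move=> gW Wp; rewrite /dotv exchange_big; apply: eq_bigr => b _.
by apply: eq_bigr => a _; rewrite (metric_onC _ _ gW Wp) mulrAC.
Qed.

Lemma lowerD g p v z a :
  lower g p (fun b => v b + z b) a = lower g p v a + lower g p z a.
Proof. by rewrite -big_split; apply: eq_bigr => b _; rewrite mulrDr. Qed.

Lemma lowerZ g p (k : R) v a :
  lower g p (fun b => k * v b) a = k * lower g p v a.
Proof. by rewrite /lower mulr_sumr; apply: eq_bigr => b _; rewrite mulrCA. Qed.

Lemma dotvDr g p v z w :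
  dotv g p w (fun b => v b + z b) = dotv g p w v + dotv g p w z.
Proof.
by rewrite !dotvE -big_split; apply: eq_bigr => b _ /=; rewrite lowerD mulrDr.
Qed.

Lemma dotvZr g p (k : R) v w : dotv g p w (fun b => k * v b) = k * dotv g p w v.
Proof.
by rewrite !dotvE mulr_sumr; apply: eq_bigr => b _; rewrite lowerZ mulrCA.
Qed.

Lemma dotvDl W g p v z w : metric_on W g -> W p ->
  dotv g p (fun b => v b + z b) w = dotv g p v w + dotv g p z w.
Proof. by move=> gW Wp; rewrite !(dotvC _ w gW Wp) dotvDr. Qed.

Lemma dotvZl W g p (k : R) v w : metric_on W g -> W p ->
  dotv g p (fun b => k * v b) w = k * dotv g p v w.
Proof. by move=> gW Wp; rewrite !(dotvC _ w gW Wp) dotvZr. Qed.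

Lemma pairing_lower W g p v z : metric_on W g -> W p ->
  pairing (lower g p v) z = dotv g p v z.
Proof.
move=> gW Wp; rewrite (dotvC _ _ gW Wp) dotvE.
by apply: eq_bigr => a _; rewrite mulrC.
Qed.

Lemma raise_lower g p v a : g p \in unitmx -> raise g p (lower g p v) a = v a.
Proof.
move=> ug; rewrite /lower /raise.
under eq_bigr do rewrite mulr_sumr.
rewrite exchange_big /=.
have /matrixP gV := mulVmx ug.
under eq_bigr => c _.
  under eq_bigr do rewrite mulrA.
  rewrite -mulr_suml.
  have := gV a c; rewrite !mxE => ->; over.
rewrite (bigD1 a) //= eqxx mul1r big1 ?addr0 // => c ca.
by rewrite eq_sym (negbTE ca) mul0r.
Qed.

Lemma dotc_lower W g p v z : metric_on W g -> W p ->
  dotc g p (lower g p v) (lower g p z) = dotv g p v z.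
Proof.
move=> gW Wp; rewrite -(pairing_lower _ _ gW Wp); apply: eq_bigr => a _.
rewrite -[z a](raise_lower z a (metric_on_unit gW Wp)) /raise mulr_sumr.
by apply: eq_bigr => b _; rewrite mulrCA mulrA.
Qed.

(** * Compatibility of the Levi-Civita connection with the metric *)

Lemma pd_metricC W g p r a b : metric_on W g -> W p ->
  pd r (fun q => g q a b) p = pd r (fun q => g q b a) p.
Proof.
move=> gW Wp; apply: near_eq_derive.
apply: filterS (open_nbhs_nbhs (conj (metric_on_open gW) Wp)) => q Wq.
exact: metric_onC Wq.
Qed.

(** Lowering the upper index cancels the inverse metric and leaves the Christoffel symbol of the
    first kind, called [K] in the proof. *)
Lemma lower_christoffel g p d b r : g p \in unitmx ->
  \sum_a g p d a * christoffel g p a b r =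
  2^-1 * (pd b (fun q => g q d r) p + pd r (fun q => g q d b) p
          - pd d (fun q => g q b r) p).
Proof.
move=> ug; pose K s := 2^-1 * (pd b (fun q => g q s r) p
  + pd r (fun q => g q s b) p - pd s (fun q => g q b r) p).
rewrite -/(K d) -(lower_raise K d ug); apply: eq_bigr => a _.
rewrite /christoffel /raise mulr_sumr; congr (_ * _).
by apply: eq_bigr => s _; rewrite /K mulrCA.
Qed.

(** This is the vanishing of the covariant derivative of g. In the sum of the two symbols of the
    first kind the derivatives in directions [a] and [b] cancel by symmetry of g, and those in
    direction [r] add up. *)
Lemma pd_metric W g p r a b : metric_on W g -> W p ->
  pd r (fun q => g q a b) p =
  \sum_c g p a c * christoffel g p c b r + \sum_c g p b c * christoffel g p c a r.
Proof.
move=> gW Wp; rewrite !lower_christoffel ?(metric_on_unit gW) //.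
rewrite (pd_metricC r b a gW Wp) (pd_metricC a b r gW Wp).
rewrite (pd_metricC b a r gW Wp).
by field.
Qed.

(** The connection matrix evaluated on the velocity. With it the covariant derivative along the
    curve is V' + CV for vectors and V' - VC for covectors. *)
Definition connection g X t a b :=
  \sum_r christoffel g (X t) a b r * velocity X t r.

Lemma covDvE g X V t a : covDv g X V t a =
  derive1 (fun s => V s a) t + \sum_b connection g X t a b * V t b.
Proof.
congr (_ + _); apply: eq_bigr => b _; rewrite mulr_suml.
by apply: eq_bigr => r _; rewrite mulrAC.
Qed.

Lemma covDcE g X V t a : covDc g X V t a =
  derive1 (fun s => V s a) t - \sum_b V t b * connection g X t b a.
Proof.
congr (_ - _); apply: eq_bigr => b _; rewrite mulr_sumr.
by apply: eq_bigr => r _; rewrite mulrAC mulrC.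
Qed.

(** Chain rule followed by metric compatibility, with the sum over the direction of differentiation
    absorbed in [connection]. *)
Lemma is_derive_metric W O g X t a b : metric_on W g -> curve_in W O X -> O t ->
  is_derive t 1 (fun s => g (X s) a b)
    (\sum_c (g (X t) a c * connection g X t c b
             + g (X t) b c * connection g X t c a)).
Proof.
move=> gW cX Ot; have WX := curve_in_sub cX Ot.
have dg := @is_derive_comp_curve _ _ (fun q => g q a b) X t
  (metric_on_smooth gW a b [::] WX) (curve_in_derivable cX Ot).
apply: is_derive_eq dg _.
under eq_bigr do rewrite (pd_metric _ _ _ gW WX) mulrDl !mulr_suml.
rewrite big_split /= exchange_big [X in _ + X]exchange_big -big_split /=.
apply: eq_bigr => c _; rewrite /connection !mulr_sumr.
by congr (_ + _); apply: eq_bigr => r _; rewrite mulrA.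
Qed.

Lemma is_derive_lower W O g X V t a : metric_on W g -> curve_in W O X -> O t ->
  field_derivable V t ->
  is_derive t 1 (fun s => lower g (X s) (V s) a)
    (lower g (X t) (covDv g X V t) a
     + \sum_b lower g (X t) (V t) b * connection g X t b a).
Proof.
move=> gW cX Ot dV; rewrite /lower.
apply: is_derive_eq.
  apply: is_derive_bigsum => b _.
  exact: (is_deriveM (is_derive_metric a b gW cX Ot)
    (is_derive_derive1 (dV b))).
rewrite big_split /=.
under [in RHS]eq_bigr do rewrite covDvE mulrDr.
rewrite [in RHS]big_split /= -addrA; congr (_ + _).
(* The derivative of the metric has two halves: the first completes the derivative of [V] to its
   covariant derivative, the second is the connection term on the lowered components. *)
under eq_bigr => b _.
  rewrite /GRing.scale /= mulr_sumr; under eq_bigr do rewrite mulrDr.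
  rewrite big_split /=; over.
rewrite big_split /=; congr (_ + _).
  rewrite exchange_big; apply: eq_bigr => c _ /=; rewrite mulr_sumr.
  by apply: eq_bigr => b _; ring.
rewrite exchange_big; apply: eq_bigr => c _ /=; rewrite mulr_suml.
apply: eq_bigr => b _; rewrite (metric_onC c b gW (curve_in_sub cX Ot)).
by rewrite mulrA [V t b * _]mulrC.
Qed.

(** The connection term in the derivative of the lowered components is exactly the one that [covDc]
    subtracts. Momenta can thus be differentiated as vectors. *)
Lemma covDc_lower W O g X V t a : metric_on W g -> curve_in W O X -> O t ->
  field_derivable V t ->
  covDc g X (fun s => lower g (X s) (V s)) t a = lower g (X t) (covDv g X V t) a.
Proof.
move=> gW cX Ot dV; rewrite covDcE.
by rewrite (derive1_is_derive (is_derive_lower a gW cX Ot dV)) addrK.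
Qed.

Lemma is_derive_dotv W O g X V Z t : metric_on W g -> curve_in W O X -> O t ->
  field_derivable V t -> field_derivable Z t ->
  is_derive t 1 (fun s => dotv g (X s) (V s) (Z s))
    (dotv g (X t) (covDv g X V t) (Z t) + dotv g (X t) (V t) (covDv g X Z t)).
Proof.
move=> gW cX Ot dV dZ; rewrite !dotvE.
rewrite (_ : (fun s => _) = (fun s => \sum_a V s a * lower g (X s) (Z s) a));
  last by apply: funext => s; rewrite dotvE.
apply: is_derive_eq.
  apply: is_derive_bigsum => a _.
  exact: (is_deriveM (is_derive_derive1 (dV a))
     (is_derive_lower a gW cX Ot dZ)).
rewrite -big_split /=.
under eq_bigr do rewrite /GRing.scale /= mulrDr -addrA.
under [in RHS]eq_bigr do rewrite covDvE mulrDl.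
(* The product is the contraction of [V] with the lowered [Z]; the connection term coming from the
   latter is the one missing in the covariant derivative of [V]. *)
rewrite !big_split /= [LHS]addrC [X in X + _ = _]addrC; congr (_ + _ + _).
- by apply: eq_bigr => a _; rewrite mulrC.
- under eq_bigr do rewrite mulr_sumr.
  rewrite exchange_big; apply: eq_bigr => b _ /=; rewrite mulr_suml.
  by apply: eq_bigr => a _; ring.
Qed.

Lemma covDvD g X V Z t a : field_derivable V t -> field_derivable Z t ->
  covDv g X (fun s b => V s b + Z s b) t a = covDv g X V t a + covDv g X Z t a.
Proof.
move=> dV dZ; rewrite !covDvE.
rewrite (derive1_is_derive (is_deriveD (is_derive_derive1 (dV a))
  (is_derive_derive1 (dZ a)))).
under eq_bigr do rewrite mulrDr.
by rewrite big_split /= addrACA.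
Qed.

Lemma covDvZ g X f (df : R) V t a : is_derive t 1 f df -> field_derivable V t ->
  covDv g X (fun s b => f s * V s b) t a = df * V t a + f t * covDv g X V t a.
Proof.
move=> dfP dV; rewrite !covDvE.
rewrite (derive1_is_derive (is_deriveM dfP (is_derive_derive1 (dV a)))).
under eq_bigr do rewrite mulrCA.
by rewrite -mulr_sumr /GRing.scale /=; ring.
Qed.

Lemma field_derivableD V Z t : field_derivable V t -> field_derivable Z t ->
  field_derivable (fun s b => V s b + Z s b) t.
Proof. by move=> dV dZ a; exact: (derivableD (dV a) (dZ a)). Qed.

Lemma field_derivableZ f V t : derivable f t 1 -> field_derivable V t ->
  field_derivable (fun s b => f s * V s b) t.
Proof. by move=> df dV a; exact: (derivableM df (dV a)). Qed.

Lemma covDv_eq_on O g X V Z t a : open O -> O t ->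
  (forall s, O s -> V s = Z s) -> covDv g X V t a = covDv g X Z t a.
Proof.
move=> oO Ot VZ; rewrite !covDvE VZ //.
by rewrite (derive1_eq_on (h := fun s => Z s a) oO Ot) // => s /VZ->.
Qed.

Lemma covDc_eq_on O g X V Z t a : open O -> O t ->
  (forall s, O s -> V s = Z s) -> covDc g X V t a = covDc g X Z t a.
Proof.
move=> oO Ot VZ; rewrite !covDcE VZ //.
by rewrite (derive1_eq_on (h := fun s => Z s a) oO Ot) // => s /VZ->.
Qed.

(** Needed to differentiate u' once more, since its components contain these symbols. *)
Lemma derivable_christoffel W O g X t a b r :
  metric_on W g -> curve_in W O X -> O t ->
  derivable (fun s => christoffel g (X s) a b r) t 1.
Proof.
move=> gW cX Ot; have WX := curve_in_sub cX Ot.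
have dX := curve_in_derivable cX Ot.
have dpd c i j : derivable (fun s => pd c (fun q => g q i j) (X s)) t 1.
  (* Smoothness at the list [[:: c]] is differentiability of the first partial derivative. *)
  have [] // := @is_derive_comp_curve _ _ (pd c (fun q => g q i j)) X t
    (metric_on_smooth gW i j [:: c] WX) dX.
apply: derivableM; first exact: derivable_cst.
apply: derivable_bigsum => s _; apply: derivableM.
  apply: (@derivable_invmx _ O _ (fun s => g (X s))) => //.
  - exact: curve_in_open cX.
  - by move=> s' Os'; apply: (metric_on_unit gW); exact: (curve_in_sub cX).
  - by move=> i j; have [] := is_derive_metric i j gW cX Ot.
by apply: derivableB => //; apply: derivableD.
Qed.

Lemma covDv_velocity_derivable W O g X t :
  metric_on W g -> curve_in W O X -> O t ->
  field_derivable (covDv g X (velocity X)) t.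
Proof.
move=> gW cX Ot a; apply: derivableD; first exact: (acceleration_derivable cX Ot).
apply: derivable_bigsum => b _; apply: derivable_bigsum => r _.
apply: derivableM; last exact: (velocity_derivable cX Ot).
apply: derivableM; last exact: (velocity_derivable cX Ot).
exact: derivable_christoffel gW cX Ot.
Qed.

(** * Change of parameter *)

Lemma velocity_comp X (th : R -> R) s a : derivable th s 1 ->
  field_derivable (fun s' a => X s' 0 a) (th s) ->
  velocity (X \o th) s a = derive1 th s * velocity X (th s) a.
Proof.
move=> dth dX; rewrite /velocity mulrC.
exact: (derive1_comp (f := th) (g := fun s' => X s' 0 a) dth (dX a)).
Qed.

Lemma connection_comp g X (th : R -> R) s a b : derivable th s 1 ->
  field_derivable (fun s' a => X s' 0 a) (th s) ->
  connection g (X \o th) s a b = derive1 th s * connection g X (th s) a b.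
Proof.
move=> dth dX; rewrite /connection mulr_sumr; apply: eq_bigr => r _.
by rewrite (velocity_comp r dth dX) mulrCA.
Qed.

(** The ordinary derivative scales by the chain rule, the connection term because it is linear in
    the velocity. *)
Lemma covDv_comp g X (th : R -> R) V s a : derivable th s 1 ->
  field_derivable (fun s' a => X s' 0 a) (th s) -> field_derivable V (th s) ->
  covDv g (X \o th) (V \o th) s a = derive1 th s * covDv g X V (th s) a.
Proof.
move=> dth dX dV; rewrite !covDvE mulrDr mulr_sumr; congr (_ + _).
  by rewrite [RHS]mulrC; exact: (derive1_comp (g := fun s' => V s' a) dth (dV a)).
by apply: eq_bigr => b _; rewrite (connection_comp g a b dth dX) mulrA.
Qed.

Lemma covDc_comp g X (th : R -> R) V s a : derivable th s 1 ->
  field_derivable (fun s' a => X s' 0 a) (th s) -> field_derivable V (th s) ->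
  covDc g (X \o th) (V \o th) s a = derive1 th s * covDc g X V (th s) a.
Proof.
move=> dth dX dV; rewrite !covDcE mulrBr mulr_sumr; congr (_ - _).
  by rewrite [RHS]mulrC; exact: (derive1_comp (g := fun s' => V s' a) dth (dV a)).
by apply: eq_bigr => b _; rewrite (connection_comp g b a dth dX) mulrCA.
Qed.

(** The force is quadratic in the velocity, hence the square. *)
Lemma curvature_force_comp g X (th : R -> R) w s a : derivable th s 1 ->
  field_derivable (fun s' a => X s' 0 a) (th s) ->
  curvature_force g (X \o th) w s a
  = derive1 th s ^+ 2 * curvature_force g X w (th s) a.
Proof.
move=> dth dX; rewrite /curvature_force mulrN mulr_sumr; congr (- _).
apply: eq_bigr => b _; rewrite mulr_sumr; apply: eq_bigr => r _.
rewrite mulr_sumr; apply: eq_bigr => c _.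
by rewrite (velocity_comp r dth dX) (velocity_comp b dth dX) /=; ring.
Qed.

Lemma curvature_forceZ g X (k : R) w t a :
  curvature_force g X (fun b => k * w b) t a = k * curvature_force g X w t a.
Proof.
rewrite /curvature_force mulrN mulr_sumr; congr (- _).
apply: eq_bigr => b _; rewrite mulr_sumr; apply: eq_bigr => r _.
by rewrite mulr_sumr; apply: eq_bigr => c _; ring.
Qed.

End Geometry.

(** * The Hamilton equations *)

Section HamiltonEquations.
Set Implicit Arguments.
Unset Strict Implicit.
Context {R : realType} {n : nat}.
Implicit Types (g : 'rV[R]_n -> 'M[R]_n) (X : R -> 'rV[R]_n).

Lemma derive1_hamiltonian_gamma (A gam psi eta : R) : 0 < gam ->
  derive1 (fun z => hamiltonian A z psi eta) gam
  = 3 / 8 * Num.sqrt gam * eta - A / (2 * Num.sqrt gam).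
Proof.
move=> gam0; have ds := is_derive1_sqrt gam0.
have d3 := is_deriveX 3 ds.
have d := is_deriveB (is_deriveD (is_derive_cst psi gam 1)
  (is_deriveM (is_deriveM d3 (is_derive_cst (4^-1 : R) gam 1))
     (is_derive_cst eta gam 1))) (is_deriveM (is_derive_cst A gam 1) ds).
rewrite (derive1_is_derive (f := fun z => hamiltonian A z psi eta) d).
have s0 : Num.sqrt gam != 0 by rewrite gt_eqF // sqrtr_gt0.
by rewrite /GRing.scale /= /cst !mulr0 !add0r addr0; field.
Qed.

(** H is affine in psi with slope 1 and in eta with slope N^3/4, where N = ||u||; only the
    derivative in gamma involves the square root, and there gamma > 0 is used. *)
Lemma hamilton_equations_hamiltonian A g X w w1 mu t
  (u := velocity X) (gam := dotv g (X t) (u t) (u t)) : 0 < gam ->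
  hamilton_equations (hamiltonian A) g X w w1 mu t <->
  forall a : 'I_n,
     [/\ covDv g X u t a
         = 2^-1 * Num.sqrt gam ^+ 3 * raise g (X t) (w1 t) a + mu t * u t a,
         covDc g X w t a = curvature_force g X (w1 t) t a
       & covDc g X w1 t a
         = - (3 / 4 * Num.sqrt gam * dotc g (X t) (w1 t) (w1 t)
              * lower g (X t) (u t) a)
           - w t a - mu t * w1 t a
           + A / Num.sqrt gam * lower g (X t) (u t) a ].
Proof.
move=> gam0; rewrite /hamilton_equations /= -/u -/gam.
set psi := pairing _ _; set eta := dotc _ _ _ _.
have -> : derive1 (fun z => hamiltonian A gam z eta) psi = 1.
  have d := is_deriveD (is_derive_id psi 1)
    (is_derive_cst (Num.sqrt gam ^+ 3 / 4 * eta - A * Num.sqrt gam) psi 1).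
  rewrite -[RHS]addr0; apply: derive1_is_derive.
  by rewrite /hamiltonian; under eq_fun do rewrite -addrA.
have -> : derive1 (fun z => hamiltonian A gam psi z) eta = Num.sqrt gam ^+ 3 / 4.
  have d := is_deriveB (is_deriveD (is_derive_cst psi eta 1)
    (is_deriveM (is_derive_cst (Num.sqrt gam ^+ 3 / 4) eta 1) (is_derive_id eta 1)))
    (is_derive_cst (A * Num.sqrt gam) eta 1).
  rewrite (derive1_is_derive (f := fun z => hamiltonian A gam psi z) d).
  by rewrite /GRing.scale /= /cst mulr0 addr0 add0r subr0 mulr1.
rewrite derive1_hamiltonian_gamma //.
have s0 : Num.sqrt gam != 0 by rewrite gt_eqF // sqrtr_gt0.
by split=> H a; have [-> -> ->] := H a; split=> //; rewrite invr1; field.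
Qed.

End HamiltonEquations.

(** * Momenta and the equation of motion *)

Section Dynamics.
Set Implicit Arguments.
Unset Strict Implicit.
Context {R : realType} {n : nat}.
Implicit Types (W : set 'rV[R]_n) (O : set R) (g : 'rV[R]_n -> 'M[R]_n)
  (X : R -> 'rV[R]_n) (t : R).

Record regular_curve W O g X : Prop := RegularCurve {
  regular_metric : metric_on W g;
  regular_curve_in : curve_in W O X;
  regular_gamma_gt0 : forall t, O t ->
    0 < dotv g (X t) (velocity X t) (velocity X t) }.

Definition tangential g X t :=
  dotv g (X t) (velocity X t) (covDv g X (velocity X) t).

(** * Derivatives of the speed and of u . u' *)

Section Kinematics.
Variables (W : set 'rV[R]_n) (O : set R) (g : 'rV[R]_n -> 'M[R]_n)
  (X : R -> 'rV[R]_n) (t : R).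
Hypotheses (sX : regular_curve W O g X) (Ot : O t).
Let u := velocity X.
Let u' := covDv g X u.
Let u'' := covDv g X u'.
Let N := speed g X.
Let p := tangential g X.
Let gW := regular_metric sX.
Let cX := regular_curve_in sX.
Let WX : W (X t) := curve_in_sub cX Ot.

Lemma speed_gt0 : 0 < N t.
Proof. by rewrite sqrtr_gt0; exact: (regular_gamma_gt0 sX). Qed.

Lemma sqr_speed : N t ^+ 2 = dotv g (X t) (u t) (u t).
Proof. by rewrite sqr_sqrtr // ltW //; exact: (regular_gamma_gt0 sX). Qed.

Lemma is_derive_speed : is_derive t 1 N (p t / N t).
Proof.
have du := velocity_derivable cX Ot.
have d := is_derive_comp_sqrt (is_derive_dotv gW cX Ot du du)
  (regular_gamma_gt0 sX Ot).
apply: is_derive_eq d _; rewrite (dotvC _ _ gW WX).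
have := speed_gt0; rewrite -/(tangential g X t) -/p -[Num.sqrt _]/(N t) => N0.
by field; rewrite gt_eqF.
Qed.

Lemma is_derive_tangential : is_derive t 1 p
  (dotv g (X t) (u' t) (u' t) + dotv g (X t) (u t) (u'' t)).
Proof.
exact: (is_derive_dotv gW cX Ot (velocity_derivable cX Ot)
  (covDv_velocity_derivable gW cX Ot)).
Qed.

End Kinematics.

(** * Multiplier and momenta in an arbitrary parameter *)

Section Momentum.
Variables (W : set 'rV[R]_n) (O : set R) (g : 'rV[R]_n -> 'M[R]_n)
  (X : R -> 'rV[R]_n) (w w1 : R -> 'I_n -> R) (mu : R -> R) (A : R).
Hypothesis sX : regular_curve W O g X.
Let u := velocity X.
Let u' := covDv g X u.
Let u'' := covDv g X u'.
Let N := speed g X.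
Let p := tangential g X.
Let gW := regular_metric sX.
Let cX := regular_curve_in sX.
Hypothesis hamilton : forall t, O t ->
  hamilton_equations (hamiltonian A) g X w w1 mu t.
Hypothesis zermelo : forall t, O t -> pairing (w1 t) (u t) = 0.

Lemma velocity_equation t : O t -> u' t =
  fun a => 2^-1 * N t ^+ 3 * raise g (X t) (w1 t) a + mu t * u t a.
Proof.
move=> Ot; apply: funext => a.
by have [] := (hamilton_equations_hamiltonian A w w1 mu (regular_gamma_gt0 sX Ot)).1
  (hamilton Ot) a.
Qed.

Lemma multiplier t : O t -> mu t = p t / N t ^+ 2.
Proof.
move=> Ot; have ug := metric_on_unit gW (curve_in_sub cX Ot).
have N0 := speed_gt0 sX Ot.
suff -> : p t = mu t * N t ^+ 2 by field; rewrite gt_eqF.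
(* In the contraction with u, the momentum term becomes the pairing of [w1] with u, which is zero by
   the Zermelo condition. *)
rewrite /p /tangential -/u -/u' (velocity_equation Ot) dotvDr !dotvZr.
rewrite (sqr_speed sX Ot) dotvE.
under eq_bigr do rewrite lower_raise // mulrC.
by rewrite -/(pairing (w1 t) (u t)) zermelo // mulr0 add0r.
Qed.

(** The first momentum with raised index, from the velocity equation solved for it with mu = p /
    N^2. It is kept as a sum of function times field, the form to which the Leibniz rule applies. *)
Let z t a := 2 * (N t ^+ 3)^-1 * u' t a + - (2 * p t * (N t ^+ 5)^-1) * u t a.

Lemma first_momentum t : O t -> w1 t = lower g (X t) (z t).
Proof.
move=> Ot; apply: funext => a.
have ug := metric_on_unit gW (curve_in_sub cX Ot).
have N0 : N t != 0 by rewrite gt_eqF // (speed_gt0 sX Ot).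
rewrite -[LHS](lower_raise _ _ ug); congr (lower _ _ _ _).
apply: funext => b; rewrite /z (velocity_equation Ot) (multiplier Ot).
by field.
Qed.

(** The third Hamilton equation, solved for [w] after [w1] and its covariant derivative have been
    expressed by u, u', u''. *)
Lemma second_momentum t a : O t ->
  let dot := dotv g (X t) in
  w t a = 6 * (dot (u' t) (u t) / N t ^+ 5) * lower g (X t) (u' t) a
          + (2 * (dot (u'' t) (u t) / N t ^+ 5)
             - 5 * (dot (u' t) (u t) ^+ 2 / N t ^+ 7)
             - dot (u' t) (u' t) / N t ^+ 5) * lower g (X t) (u t) a
          - 2 * (lower g (X t) (u'' t) a / N t ^+ 3)
          + A / N t * lower g (X t) (u t) a.
Proof.
move=> Ot; have WX := curve_in_sub cX Ot.
have N0 : N t != 0 by rewrite gt_eqF // (speed_gt0 sX Ot).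
have du := velocity_derivable cX Ot.
have du' := covDv_velocity_derivable gW cX Ot.
have dN := is_derive_speed sX Ot.
have dp := is_derive_tangential sX Ot.
pose q := dotv g (X t) (u' t) (u' t); pose r := dotv g (X t) (u t) (u'' t).
(* The two coefficients of [z] are differentiated with N' = p / N and p' = q + r. *)
have df : is_derive t 1 (fun s => 2 * (N s ^+ 3)^-1) (- (6 * p t / N t ^+ 5)).
  apply: is_derive_congr (is_derive_scale 2 (is_derive_expV 3 dN N0)) _.
  by rewrite -/N -/p; field.
have dh : is_derive t 1 (fun s => - (2 * p s * (N s ^+ 5)^-1))
    (10 * p t ^+ 2 / N t ^+ 7 - 2 * (q + r) / N t ^+ 5).
  apply: is_derive_congr (is_deriveN (is_derive_mul
    (is_derive_scale 2 dp) (is_derive_expV 5 dN N0))) _.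
  by rewrite -/N -/p -/u -/u' -/u'' -/q -/r; field.
have [_ _] := (hamilton_equations_hamiltonian A w w1 mu (regular_gamma_gt0 sX Ot)).1
  (hamilton Ot) a.
(* The formula for [w1] holds on the open set [O], so it may be used under the covariant
   derivative. *)
rewrite (covDc_eq_on _ _ _ (curve_in_open cX) Ot first_momentum).
have dfu := field_derivableZ (let: DeriveDef d _ := df in d) du'.
have dhu := field_derivableZ (let: DeriveDef d _ := dh in d) du.
rewrite (covDc_lower _ gW cX Ot (field_derivableD dfu dhu)).
rewrite (funext (fun b => covDvD g X b dfu dhu)) lowerD.
rewrite (funext (fun b => covDvZ g X b df du')).
rewrite (funext (fun b => covDvZ g X b dh du)) lowerD [X in _ + X]lowerD !lowerZ.
rewrite (first_momentum Ot) (dotc_lower _ _ gW WX).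
rewrite (multiplier Ot).
have -> b : lower g (X t) (z t) b = 2 * (N t ^+ 3)^-1 * lower g (X t) (u' t) b
    + - (2 * p t * (N t ^+ 5)^-1) * lower g (X t) (u t) b.
  by rewrite [z t]/z lowerD !lowerZ.
(* The square of the first momentum, expanded by bilinearity with u . u = N^2. *)
have -> : dotv g (X t) (z t) (z t) = (2 * (N t ^+ 3)^-1) ^+ 2 * q
    - 2 * (2 * (N t ^+ 3)^-1) * (2 * p t * (N t ^+ 5)^-1) * p t
    + (2 * p t * (N t ^+ 5)^-1) ^+ 2 * N t ^+ 2.
  rewrite /z dotvDr !dotvZr 2!(dotvDl _ _ _ gW WX) !(dotvZl _ _ _ gW WX).
  rewrite (dotvC (u' t) (u t) gW WX) -(sqr_speed sX Ot) -/N.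
  by rewrite -/(tangential g X t) -/p -/q; ring.
(* Equation and goal are both brought to the form difference = 0. The covector [w] has coefficient 1
   in each, and the two differences agree as rational expressions. *)
rewrite /= (dotvC (u' t) (u t) gW WX) (dotvC (u'' t) (u t) gW WX).
rewrite -/(tangential g X t) -/p -/q -/r -[Num.sqrt _]/(N t) -/u -/u' -/u''.
move=> /eqP; rewrite -subr_eq0 => /eqP E; apply/eqP; rewrite -subr_eq0.
by apply/eqP; apply: etrans E; field.
Qed.

(** * Passage to a natural parameter *)

Section NaturalParameter.
Variables (J : set R) (th : R -> R).
Let Y := X \o th.
Hypotheses (oJ : open J) (thO : forall s, J s -> O (th s))
  (dth : forall s, J s -> derivable th s 1)
  (th_gt0 : forall s, J s -> 0 < derive1 th s)
  (unitY : forall s, J s -> dotv g (Y s) (velocity Y s) (velocity Y s) = 1)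
  (dw : forall t, O t -> field_derivable w t).

Lemma velocity_natural s : J s ->
  velocity Y s = fun a => derive1 th s * u (th s) a.
Proof.
move=> Js; apply: funext => a; apply: velocity_comp (dth Js) _.
exact: (curve_in_derivable cX (thO Js)).
Qed.

Lemma derive1_natural s : J s -> derive1 th s = (N (th s))^-1.
Proof.
move=> Js; have Os := thO Js; have N0 := speed_gt0 sX Os.
have := unitY Js; rewrite velocity_natural // dotvZr.
rewrite (dotvZl _ _ _ gW (curve_in_sub cX Os)) -(sqr_speed sX Os) -/N.
(* Unit speed says that the square of theta' N is 1; the root -1 is excluded because both factors
   are positive. *)
rewrite mulrA -expr2 -exprMn => /eqP; rewrite sqrf_eq1 => /orP[] /eqP E.
  by apply: (mulIf (lt0r_neq0 N0)); rewrite E mulVf ?gt_eqF.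
have := mulr_gt0 (th_gt0 Js) N0.
by rewrite E oppr_gt0 ltr10.
Qed.

(** Here [e], [e'], [e''] are Dx/ds, D^2x/ds^2, D^3x/ds^3 as functions of the original parameter,
    each obtained from the previous one by D/ds = (1/N) D/dtau. *)
Let e t a := (N t)^-1 * u t a.
Let e' t a := (N t ^+ 2)^-1 * u' t a + - (p t * (N t ^+ 4)^-1) * u t a.
Let e'' t a := (N t ^+ 3)^-1 * u'' t a + (- (3 * p t * (N t ^+ 5)^-1) * u' t a
  + (4 * p t ^+ 2 / N t ^+ 7
     - (dotv g (X t) (u' t) (u' t) + dotv g (X t) (u t) (u'' t)) / N t ^+ 5)
    * u t a).

Lemma covDv_natural V s a : J s -> field_derivable V (th s) ->
  covDv g Y (V \o th) s a = (N (th s))^-1 * covDv g X V (th s) a.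
Proof.
move=> Js dV; rewrite -(derive1_natural Js).
exact: (covDv_comp g a (dth Js) (curve_in_derivable cX (thO Js)) dV).
Qed.

Lemma velocity_naturalE s : J s -> velocity Y s = e (th s).
Proof. by move=> Js; rewrite velocity_natural // derive1_natural. Qed.

Lemma acceleration_natural s : J s -> covDv g Y (velocity Y) s = e' (th s).
Proof.
move=> Js; have Os := thO Js; apply: funext => a.
rewrite (covDv_eq_on (Z := e \o th) g Y a oJ Js); last first.
  by move=> r Jr; rewrite velocity_naturalE.
set t := th s in Os *.
have N0 : N t != 0 by rewrite gt_eqF // (speed_gt0 sX Os).
have df := is_derive_expV 1 (is_derive_speed sX Os) N0.
have du := velocity_derivable cX Os.
have de := field_derivableZ (let: DeriveDef d _ := df in d) du.
rewrite (covDv_natural a Js de) -/t (covDvZ g X a df du) /e' -/N -/p -/u -/u'.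
by field.
Qed.

Lemma jerk_natural s : J s ->
  covDv g Y (covDv g Y (velocity Y)) s = e'' (th s).
Proof.
move=> Js; have Os := thO Js; apply: funext => a.
rewrite (covDv_eq_on (Z := e' \o th) g Y a oJ Js); last first.
  by move=> r Jr; rewrite acceleration_natural.
set t := th s in Os *.
have N0 : N t != 0 by rewrite gt_eqF // (speed_gt0 sX Os).
have dN := is_derive_speed sX Os.
have du := velocity_derivable cX Os.
have du' := covDv_velocity_derivable gW cX Os.
have df := is_derive_expV 2 dN N0.
(* Derivative of the coefficient of u in [e']. *)
have dh : is_derive t 1 (fun r => - (p r * (N r ^+ 4)^-1))
    (4 * p t ^+ 2 / N t ^+ 6
     - (dotv g (X t) (u' t) (u' t) + dotv g (X t) (u t) (u'' t)) / N t ^+ 4).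
  apply: is_derive_congr (is_deriveN (is_derive_mul (is_derive_tangential sX Os)
    (is_derive_expV 4 dN N0))) _.
  by rewrite -/N -/p -/u -/u' -/u''; field.
have dfu := field_derivableZ (let: DeriveDef d _ := df in d) du'.
have dhu := field_derivableZ (let: DeriveDef d _ := dh in d) du.
rewrite (covDv_natural a Js (field_derivableD dfu dhu)) -/t.
rewrite (covDvD g X a dfu dhu) (covDvZ g X a df du') (covDvZ g X a dh du).
rewrite /e'' -/N -/p -/u -/u' -/u''.
by field.
Qed.

(** After substitution of [e], [e'], [e''] the coefficients of u, u', u'' are those of
    [second_momentum]; in particular e' . e' = u' . u' / N^4 - p^2 / N^6. *)
Lemma natural_bracket s b : J s ->
  (- 3 * dotv g (Y s) (covDv g Y (velocity Y) s) (covDv g Y (velocity Y) s) + A)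
    * lower g (Y s) (velocity Y s) b
  - 2 * lower g (Y s) (covDv g Y (covDv g Y (velocity Y)) s) b = w (th s) b.
Proof.
move=> Js; have Os := thO Js.
rewrite acceleration_natural // jerk_natural // velocity_naturalE //.
rewrite (second_momentum b Os) /= -/(Y s).
set t := th s in Os *; have WX := curve_in_sub cX Os.
have N0 : N t != 0 by rewrite gt_eqF // (speed_gt0 sX Os).
rewrite -[Y s]/(X t).
rewrite [e t]/e lowerZ.
rewrite [e'' t]/e'' lowerD [lower _ _ (fun b => _ + _) _]lowerD !lowerZ.
have -> : dotv g (X t) (e' t) (e' t) =
    ((N t ^+ 2)^-1) ^+ 2 * dotv g (X t) (u' t) (u' t)
    - 2 * (N t ^+ 2)^-1 * (p t * (N t ^+ 4)^-1) * p t
    + (p t * (N t ^+ 4)^-1) ^+ 2 * N t ^+ 2.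
  rewrite /e' dotvDr !dotvZr 2!(dotvDl _ _ _ gW WX) !(dotvZl _ _ _ gW WX).
  rewrite (dotvC (u' t) (u t) gW WX) -(sqr_speed sX Os) -/N.
  by rewrite -/(tangential g X t) -/p; ring.
rewrite (dotvC (u' t) (u t) gW WX) (dotvC (u'' t) (u t) gW WX).
rewrite -/(tangential g X t) -/p.
by field.
Qed.

(** The left side is Dw/ds = (1/N) Dw/dtau. The two velocities in the force contribute 1/N^2, so the
    factor N on [w1] is what balances the equation; N [w1] is also the lowered 2 D^2x/ds^2. *)
Lemma motion_equation_natural s : J s ->
  motion_equation A g Y (fun s' a => N (th s') * w1 (th s') a) s.
Proof.
move=> Js; have Os := thO Js; rewrite /motion_equation /= => a.
have dX := curve_in_derivable cX Os.
rewrite (covDc_eq_on (Z := w \o th) g Y a oJ Js); last first.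
  by move=> r Jr; apply: funext => b; exact: natural_bracket.
rewrite (covDc_comp g a (dth Js) dX (dw Os)).
rewrite curvature_forceZ (curvature_force_comp g _ a (dth Js) dX).
have [_ -> _] := (hamilton_equations_hamiltonian A w w1 mu (regular_gamma_gt0 sX Os)).1
  (hamilton Os) a.
have N0 : N (th s) != 0 by rewrite gt_eqF // (speed_gt0 sX Os).
by rewrite derive1_natural //; field.
Qed.

End NaturalParameter.

End Momentum.
End Dynamics.

(** * Curves seen in a chart *)

Section ChartOfCurve.
Set Implicit Arguments.
Unset Strict Implicit.
Context {R : realType} {n : nat} (M : pseudoRiemannian R n).

(** Identities proved while the curve stays in one chart can be differentiated because they hold on
    this open set. *)
Lemma open_sees (I : set R) (x : R -> M) (c : atlas M) : open I ->
  (forall t, I t -> {for t, continuous x}) -> open (I `&` sees c x).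
Proof.
move=> oI cx; rewrite openE => t [It st].
apply: filterI; first exact: open_nbhs_nbhs.
exact: (cx _ It _ (open_nbhs_nbhs (conj (cdom_open _) st))).
Qed.

Lemma regular_in_chart (I : set R) (x : R -> M) (c : atlas M) : open I ->
  curve_on I x ->
  (forall t, I t -> sees c x t -> 0 < dotv (metric M c) (in_chart c x t)
     (velocity (in_chart c x) t) (velocity (in_chart c x) t)) ->
  regular_curve (crd (chart_of M c) @` cdom (chart_of M c)) (I `&` sees c x)
    (metric M c) (in_chart c x).
Proof.
move=> oI [cx dx] gt0; split.
- split; [exact: cimg_open|exact: metric_smooth|exact: Defs.metric_sym
    |exact: metric_nondegenerate].
- split; first exact: open_sees.
  + by move=> t [_ st]; exists (x t).
  (* Orders 0, 1, 2 give derivability of the position, the velocity and the coordinate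
     acceleration. *)
  + by move=> t [It st] a; exact: (dx c t It st a 0).
  + by move=> t [It st] a; exact: (dx c t It st a 1).
  + by move=> t [It st] a; exact: (dx c t It st a 2).
- by move=> t [It st]; exact: gt0.
Qed.

End ChartOfCurve.

Theorem mainTheorem4 (R : realType) (n : nat) (M : pseudoRiemannian R n)
    (A : R) (I : set R) (x : R -> M)
    (w w1 : atlas M -> R -> 'I_n -> R) (mu : R -> R)
    (I_open : open I) (I_interval : is_interval I)
    (hx : curve_on I x)
    (hw : covector_field_along I x w)
    (hw1 : covector_field_along I x w1)
    (gamma_gt0 : forall c t, I t -> sees c x t ->
       let g := metric M c in let X := in_chart c x in
       0 < dotv g (X t) (velocity X t) (velocity X t)) :
  (* the covariant Hamilton equations of the given Hamilton function *)
  (forall c t, I t -> sees c x t ->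
     let g := metric M c in let X := in_chart c x in
     let u := velocity X in
     let gamma := dotv g (X t) (u t) (u t) in
     hamilton_equations (hamiltonian A) g X (w c) (w1 c) mu t <->
     forall a : 'I_n,
     [/\ covDv g X u t a
         = 2^-1 * Num.sqrt gamma ^+ 3 * raise g (X t) (w1 c t) a + mu t * u t a,
         covDc g X (w c) t a = curvature_force g X (w1 c t) t a
       & covDc g X (w1 c) t a
         = - (3 / 4 * Num.sqrt gamma * dotc g (X t) (w1 c t) (w1 c t)
              * lower g (X t) (u t) a)
           - w c t a - mu t * w1 c t a
           + A / Num.sqrt gamma * lower g (X t) (u t) a ]) /\
  ((forall c t, I t -> sees c x t ->
      hamilton_equations (hamiltonian A) (metric M c) (in_chart c x)
        (w c) (w1 c) mu t) ->
   (* the Zermelo condition *)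
   (forall c t, I t -> sees c x t ->
      pairing (w1 c t) (velocity (in_chart c x) t) = 0) ->
   (forall c t, I t -> sees c x t ->
      let g := metric M c in let X := in_chart c x in
      let u := velocity X in
      let u' := covDv g X u in
      let u'' := covDv g X u' in
      let dot v v' := dotv g (X t) v v' in
      let norm := speed g X t in
      mu t = dot (u t) (u' t) / norm ^+ 2 /\
      forall a : 'I_n,
        w c t a =
          6 * (dot (u' t) (u t) / norm ^+ 5) * lower g (X t) (u' t) a
          + (2 * (dot (u'' t) (u t) / norm ^+ 5)
             - 5 * (dot (u' t) (u t) ^+ 2 / norm ^+ 7)
             - dot (u' t) (u' t) / norm ^+ 5) * lower g (X t) (u t) a
          - 2 * (lower g (X t) (u'' t) a / norm ^+ 3)
          + A / norm * lower g (X t) (u t) a) /\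
   (* if the given parameter is already natural *)
   ((forall c t, I t -> sees c x t ->
       let g := metric M c in let X := in_chart c x in
       dotv g (X t) (velocity X t) (velocity X t) = 1) ->
    forall c s, I s -> sees c x s ->
      motion_equation A (metric M c) (in_chart c x) (w1 c) s) /\
   (* in a natural parameter s introduced by tau = theta s; the momentum w1 in
      the parameter s is the given one times ||u|| *)
   (forall (J : set R) (theta : R -> R),
      open J -> is_interval J ->
      (forall s, J s -> I (theta s)) ->
      (forall s, J s -> derivable theta s 1 /\ 0 < derive1 theta s) ->
      (forall c s, J s -> sees c (x \o theta) s ->
         let g := metric M c in let Y := in_chart c (x \o theta) in
         dotv g (Y s) (velocity Y s) (velocity Y s) = 1) ->
      forall c s, J s -> sees c (x \o theta) s ->
        motion_equation A (metric M c) (in_chart c (x \o theta))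
          (fun s' a => speed (metric M c) (in_chart c x) (theta s')
                       * w1 c (theta s') a) s)).
Proof.
split.
  by move=> c t It st; exact: hamilton_equations_hamiltonian (gamma_gt0 _ _ It st).
move=> Heq Hz.
have reg c := regular_in_chart I_open hx (gamma_gt0 c).
have eqc c t (Ot : (I `&` sees c x) t) := Heq c t Ot.1 Ot.2.
have zc c t (Ot : (I `&` sees c x) t) := Hz c t Ot.1 Ot.2.
have dwc c t (Ot : (I `&` sees c x) t) := hw.2 c t Ot.1 Ot.2.
(* Proved first, because the case of an already natural parameter is its instance at the
   identity. *)
have natural (J : set R) (theta : R -> R) : open J ->
    (forall s, J s -> I (theta s)) ->
    (forall s, J s -> derivable theta s 1 /\ 0 < derive1 theta s) ->
    (forall c s, J s -> sees c (x \o theta) s ->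
      let Y := in_chart c (x \o theta) in
      dotv (metric M c) (Y s) (velocity Y s) (velocity Y s) = 1) ->
    forall c s, J s -> sees c (x \o theta) s ->
      motion_equation A (metric M c) (in_chart c (x \o theta))
        (fun s' a => speed (metric M c) (in_chart c x) (theta s')
                     * w1 c (theta s') a) s.
  move=> oJ JI dth unit c s Js ss.
  apply: (@motion_equation_natural _ _ _ _ _ _ _ _ _ _ (reg c) (eqc c) (zc c)
    (J `&` sees c (x \o theta)) theta) => //.
  (* The local result is applied on the part of [J] seen by the chart; it is open since theta, being
     derivable, is continuous. *)
  - apply: open_sees => // r Jr; apply: continuous_comp.
      by apply/differentiable_continuous/derivable1_diffP; have [] := dth _ Jr.
    exact: hx.1 (JI _ Jr).
  - by move=> r [Jr sr]; split; [exact: JI|].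
  - by move=> r [/dth[]].
  - by move=> r [/dth[]].
  - by move=> r [Jr sr]; exact: unit.
  - exact: dwc.
split.
  move=> c t It st; split.
    exact: (multiplier (reg c) (eqc c) (zc c) (conj It st)).
  by move=> a; exact: (second_momentum (reg c) (eqc c) (zc c) a (conj It st)).
split; last by move=> J theta oJ _; exact: natural.
move=> unit c s Is ss; rewrite /motion_equation /= => a.
have did r : I r -> derivable (@id R) r 1 /\ 0 < derive1 (@id R) r.
  by move=> _; rewrite derive1_id; split; [exact: derivable_id|exact: ltr01].
have := natural I id I_open (fun _ => id) did unit c s Is ss a.
(* The factor ||u|| on the first momentum equals 1 at unit speed. *)
rewrite curvature_forceZ /speed /= (unit c s Is ss) sqrtr1 mul1r; exact.
Qed.
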